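(* Let $\mathcal{D}$ be a $(v,k,1)$-BIBD with $k\geq 4$. If $v\geq k+2$ and $3\leq h\leq k-1$, then the hypergraph $H_{\mathcal{D},h}$ is 2-e.c.
   Context: A $(v,k,\lambda)$-BIBD is a pair $\mathcal{D}=(V,\mathcal{B})$ where $V$ is a set of $v$ points and $\mathcal{B}$ is a collection of $k$-subsets of $V$ (blocks) such that every pair of distinct points lies in exactly $\lambda$ blocks. For $3\le h\le k$, $H_{\mathcal{D},h}$ is the $h$-uniform hypergraph with vertex set $V$ whose edges are all $h$-subsets of the blocks of $\mathcal{D}$ (for each block $B$, all $\binom{k}{h}$ $h$-subsets of $B$ are edges). An $h$-uniform hypergraph $H$ is $n$-e.c.\ if for every set $S\subseteq V(H)$ with $|S|=n$ and every $T\subseteq S$, there is $X\subseteq V(H)\setminus S$ with $|X|=h-1$ such that $X\cup\{z\}$ is an edge for every $z\in T$ and $X\cup\{s\}$ is not an edge for every $s\in S\setminus T$. *)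

(* Defs.v *)
From mathcomp Require Import all_boot.

Set Implicit Arguments.
Unset Strict Implicit.
Unset Printing Implicit Defensive.

(* The point set is a finite type V.  Blocks are given as a sequence, so that
   a block may be repeated; their order is irrelevant. *)
Definition is_bibd (v k lambda : nat) (V : finType) (blocks : seq {set V}) : Prop :=
  [/\ #|V| = v,
      (forall B : {set V}, B \in blocks -> #|B| = k)
    & forall x y : V, x != y ->
        count (fun B : {set V} => (x \in B) && (y \in B)) blocks = lambda].

Record uniform_hypergraph (V : finType) (h : nat) : Type := UniformHypergraph {
  edges : {set {set V}};
  edges_uniform : forall e : {set V}, e \in edges -> #|e| = h
}.

Definition design_edges (V : finType) (blocks : seq {set V}) (h : nat) : {set {set V}} :=
  [set e : {set V} | (#|e| == h) && has (fun B : {set V} => e \subset B) blocks].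

Lemma design_edges_uniform (V : finType) (blocks : seq {set V}) (h : nat) (e : {set V}) :
  e \in design_edges blocks h -> #|e| = h.
Proof. by rewrite inE => /andP[/eqP]. Qed.

Definition design_hypergraph (V : finType) (blocks : seq {set V}) (h : nat) :
    uniform_hypergraph V h :=
  UniformHypergraph (@design_edges_uniform V blocks h).

Definition existentially_closed (V : finType) (h n : nat)
    (H : uniform_hypergraph V h) : Prop :=
  forall S : {set V}, #|S| = n ->
  forall T : {set V}, T \subset S ->
  exists X : {set V},
    [/\ X \subset ~: S,
        #|X| = h.-1,
        (forall z : V, z \in T -> X :|: [set z] \in edges H)
      & forall s : V, s \in S :\: T -> X :|: [set s] \notin edges H].

(* Main.v *)
(* Let S = {a, b} and let B be the block through a and b.  If T = S, take X inside
   B.  If T = {a}, take X inside a block C through a and a point outside B: X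
   has two points, so C is the only block containing X, and b is not in C.  If T
   is empty, let X contain a point of B other than a and b and a point outside B:
   a block through X and one of a, b would have to be B. *)
Require Import Defs.
From mathcomp Require Import all_boot zify.

Lemma exists_subset_card {V : finType} {A : {set V}} {n} :
  n <= #|A| -> exists2 X : {set V}, X \subset A & #|X| = n.
Proof.
move=> len; exists [set:: take n (enum A)].
  by apply/subsetP=> x; rewrite inE => /mem_take; rewrite mem_enum.
rewrite cardsE (card_uniqP _) ?take_uniq ?enum_uniq // size_takel //.
by rewrite -cardE.
Qed.

(** Pad [A] with points of [C] outside it. This will supply an [X] that contains two chosen points
    and avoids a given pair. *)
Lemma exists_card_between {V : finType} {A C : {set V}} {n} :
  A \subset C -> #|A| <= n <= #|C| ->
  exists X : {set V}, [/\ A \subset X, X \subset C & #|X| = n].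
Proof.
move=> sAC /andP[leAn lenC].
have [|Y sY cY] := @exists_subset_card V (C :\: A) (n - #|A|).
  by rewrite cardsD (setIidPr sAC) leq_sub2r.
exists (A :|: Y); split; first exact: subsetUl.
  by rewrite subUset sAC (subset_trans sY (subsetDl _ _)).
rewrite cardsU cY (_ : A :&: Y = set0) ?cards0 ?subn0 ?subnKC //.
by apply/setP=> x; rewrite !inE; apply/negP=> /andP[Ax /(subsetP sY)]; rewrite inE Ax.
Qed.

Section LinearSpace.

Context {v k h : nat} {V : finType} {blocks : seq {set V}}.
Hypothesis bibdV : is_bibd v k 1 blocks.

Lemma block_through {x y : V} : x != y ->
  exists B : {set V}, [/\ B \in blocks, x \in B & y \in B].
Proof.
case: bibdV => _ _ /[apply] c1.
have: has (fun B : {set V} => (x \in B) && (y \in B)) blocks by rewrite has_count c1.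
by case/hasP=> B ? /andP[]; exists B.
Qed.

(** The list of blocks through [x] and [y] has length 1, and both [B] and [C] occur in it. *)
Lemma block_unique {x y : V} {B C : {set V}} : x != y ->
  B \in blocks -> C \in blocks ->
  x \in B -> y \in B -> x \in C -> y \in C -> B = C.
Proof.
case: bibdV => _ _ /[apply] c1 bB bC xB yB xC yC.
move: c1; rewrite -size_filter.
have: B \in [seq D : {set V} <- blocks | (x \in D) && (y \in D)].
  by rewrite mem_filter xB yB.
have: C \in [seq D : {set V} <- blocks | (x \in D) && (y \in D)].
  by rewrite mem_filter xC yC.
by case: [seq _ <- _ | _] => [|D []] //; rewrite !inE => /eqP-> /eqP->.
Qed.

Lemma point_off_block {B : {set V}} : k < v -> B \in blocks ->
  exists x, x \notin B.
Proof.
case: bibdV => cV cB _ ltkv bB.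
have /set0Pn[x]: ~: B != set0 by rewrite -card_gt0 cardsCs setCK cV cB // subn_gt0.
by rewrite inE; exists x.
Qed.

(** Since [z] is new to [X], the size condition on an edge holds automatically; only the search for
    a block remains. *)
Lemma design_edgesU1 {X : {set V}} {z : V} : 0 < h -> #|X| = h.-1 -> z \notin X ->
  (X :|: [set z] \in design_edges blocks h)
    = has (fun B : {set V} => (X \subset B) && (z \in B)) blocks.
Proof.
move=> h0 cX zX; rewrite inE setUC cardsU1 zX cX add1n prednK // eqxx /=.
by apply: eq_has => B; rewrite subUset sub1set andbC.
Qed.

Lemma ec_pair_all {a b : V} : a != b -> 0 < h -> h < k ->
  exists X : {set V}, [/\ a \notin X, b \notin X, #|X| = h.-1,
    X :|: [set a] \in design_edges blocks h
    & X :|: [set b] \in design_edges blocks h].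
Proof.
move=> ab h0 hk; have [B [bB aB bB']] := block_through ab.
(* There is room for [X]: [B] has [k - 2] points besides [a] and [b], and [h.-1 <= k - 2] as
   [h < k]. *)
have [|X sX cX] := @exists_subset_card V (B :\: [set a; b]) h.-1.
  have [_ cB _] := bibdV; rewrite cardsD (setIidPr _) ?(cB B) ?cards2 ?ab //.
    by lia.
  by rewrite subUset !sub1set aB.
have [aX bX]: a \notin X /\ b \notin X.
  by split; apply/negP=> /(subsetP sX); rewrite !inE eqxx ?orbT.
have sXB := subset_trans sX (subsetDl _ _).
by exists X; rewrite !design_edgesU1 //; split=> //; apply/hasP; exists B; rewrite ?sXB.
Qed.

Lemma ec_pair_one {a b : V} : a != b -> 2 < h -> h < k -> k < v ->
  exists X : {set V}, [/\ a \notin X, b \notin X, #|X| = h.-1,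
    X :|: [set a] \in design_edges blocks h
    & X :|: [set b] \notin design_edges blocks h].
Proof.
move=> ab h2 hk kv; have [B [bB aB bB']] := block_through ab.
have [c cB] := point_off_block kv bB.
have ac : a != c by apply: contraNneq cB => <-.
have [C [bC aC cC]] := block_through ac.
(* Otherwise [B] and [C] share [a] and [b], so they coincide, although [c] lies only in [C]. *)
have bNC : b \notin C.
  by apply: contra cB => bC'; rewrite (block_unique ab bB bC).
have [|X sX cX] := @exists_subset_card V (C :\ a) h.-1.
  have [_ cardB _] := bibdV; have := cardsD1 a C; rewrite aC cardB //.
  by move: hk; clear; lia.
have sXC := subset_trans sX (subD1set C a).
have aX : a \notin X by apply/negP=> /(subsetP sX); rewrite !inE eqxx.
have bX : b \notin X by apply: contra bNC => /(subsetP sXC).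
have h0 : 0 < h by exact: ltn_trans h2.
exists X; rewrite !design_edgesU1 //; split=> //.
  by apply/hasP; exists C; rewrite ?sXC.
(* Here [2 < h] matters: two points of [X] force any block containing [X] to be [C], which misses
   [b]. *)
have /card_gt1P[x [y [xX yX xy]]] : 1 < #|X| by rewrite cX; case: (h) h2.
apply/hasPn=> D bD; apply/negP=> /andP[/subsetP sXD bD'].
case/negP: bNC; rewrite (@block_unique x y C D) //.
- exact: (subsetP sXC).
- exact: (subsetP sXC).
- exact: sXD.
- exact: sXD.
Qed.

Lemma ec_pair_none {a b : V} : a != b -> 2 < h -> h < k -> k < v ->
  exists X : {set V}, [/\ a \notin X, b \notin X, #|X| = h.-1,
    X :|: [set a] \notin design_edges blocks h
    & X :|: [set b] \notin design_edges blocks h].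
Proof.
move=> ab h2 hk kv; have [B [bB aB bB']] := block_through ab.
have [cV cardB _] := bibdV.
have [x xB] := point_off_block kv bB.
(* The bounds [2 < h < k] give [k >= 4], so [B] has a third point. *)
have [y] : exists y, y \in B :\: [set a; b].
  apply/set0Pn; rewrite -card_gt0 cardsD (setIidPr _) ?(cardB B) ?cards2 ?ab //.
    by lia.
  by rewrite subUset !sub1set aB.
rewrite !inE negb_or => /andP[/andP[ya yb] yB].
have xNB z : z \in B -> x != z by move=> zB; apply: contraNneq xB => ->.
(* The size fits because [2 <= h.-1 <= v - 2]. *)
have [||X [sxyX sX cX]] := @exists_card_between V [set x; y] (~: [set a; b]) h.-1.
- by rewrite subUset !sub1set !inE !negb_or ya yb !xNB.
- by rewrite cards2 xNB // cardsCs setCK cV cards2 ab; lia.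
have /andP[xX yX] : (x \in X) && (y \in X) by rewrite -!sub1set -subUset.
have [aX bX]: a \notin X /\ b \notin X.
  by split; apply/negP=> /(subsetP sX); rewrite !inE eqxx ?orbT.
have h0 : 0 < h by exact: ltn_trans h2.
(* Such a block meets [B] in [y] and [z], hence equals [B], yet it contains [x]. This is applied to
   [z = a] and [z = b]. *)
have noblock z : z \in B -> y != z ->
    ~~ has (fun D : {set V} => (X \subset D) && (z \in D)) blocks.
  move=> zB yz; apply/hasPn=> D bD; apply/negP=> /andP[/subsetP sXD zD].
  by case/negP: xB; rewrite (block_unique yz bB bD) // sXD.
by exists X; rewrite !design_edgesU1 ?noblock.
Qed.

End LinearSpace.

Theorem theorem9 (v k h : nat) (V : finType) (blocks : seq {set V}) :
  is_bibd v k 1 blocks ->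
  4 <= k ->
  k + 2 <= v ->
  3 <= h <= k - 1 ->
  existentially_closed 2 (design_hypergraph blocks h).
Proof.
move=> bibdV k4 kv /andP[h2 hk] S /eqP/cards2P[a [b [ab ->]]] T sT.
have ltkv : k < v by lia.
have lthk : h < k by lia.
have h0 : 0 < h by exact: ltn_trans h2.
(* Stated as boolean equalities, both requirements on [X] become one condition per point, and the
   four choices of [T] become a case split. *)
suff [X [aX bX cX eqa eqb]] : exists X : {set V}, [/\ a \notin X, b \notin X, #|X| = h.-1,
    (X :|: [set a] \in design_edges blocks h) = (a \in T)
    & (X :|: [set b] \in design_edges blocks h) = (b \in T)].
  exists X; split=> //.
  - by apply/subsetP=> x xX; rewrite !inE; apply/norP; split; apply: contraTneq xX => ->.
  - by move=> z zT; have := subsetP sT z zT => /set2P[] zE; rewrite zE (eqa, eqb) -zE.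
  - by move=> s /setDP[/set2P[] ->]; rewrite (eqa, eqb).
case aT: (a \in T); case bT: (b \in T).
- exact: (ec_pair_all bibdV ab).
- have [X [aX bX cX ea /negbTE eb]] := ec_pair_one bibdV ab h2 lthk ltkv.
  by exists X.
(* [T] is now the singleton of [b]: the previous case with [a] and [b] exchanged. *)
- have [|X [bX aX cX eb /negbTE ea]] := @ec_pair_one v k h V blocks bibdV b a _ h2 lthk ltkv.
    by rewrite eq_sym.
  by exists X.
- have [X [aX bX cX /negbTE ea /negbTE eb]] := ec_pair_none bibdV ab h2 lthk ltkv.
  by exists X.
Qed.
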